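(* For every field $k$, every $\mathcal F=(f_1,\ldots,f_m)\in P^m$ with $P=k[x_1,\ldots,x_n]$, and every choice of term ordering $\mu$ on $\mathbb T^n$ and compatible module term ordering $\mu'$ on $\mathbb T^n_m$, the algorithm described in the context (with input $\mathcal F,\mu,\mu'$) terminates.
   Context: Let $k$ be a field, $k^*=k\setminus\{0\}$, $P=k[x_1,\ldots,x_n]$, and let $\mathbb T^n$ be the monoid of power products of $x_1,\ldots,x_n$ with an admissible term ordering $\mu$ (a total order $<$ compatible with multiplication with $1$ as least element). Let $P^m$ be the free $P$-module with basis $e_1,\ldots,e_m$ and $\mathbb T^n_m=\{te_\ell\mid t\in\mathbb T^n,\ 1\le \ell\le m\}$ its set of module terms, with a module term ordering $\mu'$ (a total order $<$ with $\sigma<\sigma'\Rightarrow t\sigma<t\sigma'$ and $\sigma\le t\sigma$) that is compatible with $\mu$: $t<u$ implies $te_i<ue_i$ for all $i$. $\mathrm{LT}(\cdot)$ denotes leading terms with respect to $\mu$ in $P$ and $\mu'$ in $P^m$; $\mathrm{LC}(f)$ is the coefficient of $\mathrm{LT}(f)$. By convention $\mathrm{LT}(0)$ is smaller than every term. Let $\mathcal F=(f_1,\ldots,f_m)\in P^m$, $I=(f_1,\ldots,f_m)$, $v:P^m\to I$ the $P$-linear map with $v(e_i)=f_i$, $\mathrm{Syz}\,\mathcal F=\ker v$, $\mathrm{LT}(\mathrm{Syz}\,\mathcal F)$ the set of leading module terms of its nonzero elements, $\mathrm{NS}(\mathrm{Syz}\,\mathcal F)=\mathbb T^n_m\setminus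 \mathrm{LT}(\mathrm{Syz}\,\mathcal F)$. For $f\in I\setminus\{0\}$, $\mathcal S(f)$ is the leading module term of the unique preimage of $f$ under $v$ all of whose module terms lie in $\mathrm{NS}(\mathrm{Syz}\,\mathcal F)$. A nonzero $f\in I$ is $\mathcal S$-irreducible if there are no $h\in I\setminus\{0\}$, $t\in\mathbb T^n$, $\alpha\in k^*$ with $\mathrm{LT}(f-\alpha th)<\mathrm{LT}(f)$ and $\mathcal S(th)<\mathcal S(f)$. It is primitive $\mathcal S$-irreducible if moreover there are no $\mathcal S$-irreducible $f'\in I\setminus\{0\}$ and $t\in\mathbb T^n\setminus\{1\}$ with $\mathrm{LT}(tf')=\mathrm{LT}(f)$ and $t\,\mathcal S(f')=\mathcal S(tf')=\mathcal S(f)$. For nonzero $g_1,g_2\in I$ put $u_i=\dfrac{\mathrm{lcm}(\mathrm{LT}(g_1),\mathrm{LT}(g_2))}{\mathrm{LC}(g_i)\,\mathrm{LT}(g_i)}$ and $\mathrm{Spol}(g_1,g_2)=u_1g_1-u_2g_2$. Algorithm. The state consists of a set $L\subseteq\mathbb T^n_m$ (with $\langle L\rangle\subseteq P^m$ the submodule it generates), and sets $G,B$ of pairs (polynomial in $I$, element of $\mathbb T^n_m$). Initially $L=\varnothing$, $G=\varnothing$, $B=\{(f_1,e_1),\ldots,(f_m,e_m)\}$. While $B\ne\varnothing$: (a) replace $B$ by $\{(f,\sigma)\in B\mid \sigma\notin\langle L\rangle\}$; (b) remove from $B$ every $(f,\sigma)$ for which there are $(f',\sigma')\in G\cup B$ and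 $t\in\mathbb T^n$ with $t\sigma'=\sigma$ and $\mathrm{LT}(tf')<\mathrm{LT}(f)$; if $B$ is now empty, leave the loop; (c) pick and remove from $B$ some $(f,\sigma)$ with $\sigma$ minimal; (d) $\mathcal S$-reduce $f$: if $f=0$ the result is $0$; otherwise, while $f\neq0$ and there exist $(g,\sigma_g)\in G$ and $t\in\mathbb T^n$ with $t\,\mathrm{LT}(g)=\mathrm{LT}(f)$ and $t\sigma_g<\sigma$, normalize $f:=f/\mathrm{LC}(f)$ and replace $f$ by $f-tg/\mathrm{LC}(g)$; finally, if $f\ne0$, normalize $f:=f/\mathrm{LC}(f)$; (e) if the resulting $f$ is nonzero (then $\sigma=\mathcal S(f)$): for each $(g,\sigma_g)\in G$ (where $\sigma_g=\mathcal S(g)$) such that $(f,g)$ is a normal pair in the following sense — $f$ and $g$ are primitive $\mathcal S$-irreducible and, with $u_1,u_2$ the coefficients in $\mathrm{Spol}(f,g)=u_1f-u_2g$, $\mathrm{LT}(u_1)\sigma\notin\langle L\rangle$, $\mathrm{LT}(u_2)\sigma_g\notin\langle L\rangle$ and $\mathrm{LT}(u_1)\sigma\neq\mathrm{LT}(u_2)\sigma_g$ — add $(\mathrm{Spol}(f,g),\ \max(\mathrm{LT}(u_1)\sigma,\mathrm{LT}(u_2)\sigma_g))$ to $B$; then add $(f,\sigma)$ to $G$; (f) if the resulting $f$ is zero, add $\sigma$ to $L$. When the loop ends, return $\{g\mid (g,\sigma)\in G\}$. *)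

(* Defs.v *)
From HB Require Import structures.
From mathcomp Require Import all_boot all_order all_algebra.
From mathcomp Require Import finmap.
From mathcomp Require Import boolp classical_sets.
From mathcomp Require Export mpoly.

Set Implicit Arguments.
Unset Strict Implicit.
Unset Printing Implicit Defensive.

Import GRing.Theory.

Local Open Scope fset_scope.
Local Open Scope ring_scope.

(* A power product is its exponent vector in 'X_{1..n}, whose monoid law is
   written additively: [(t + u)%MM] is the product tu and [0%MM] is 1.
   The pair [(t, i)] is the module term t e_i. *)
Notation mterm n m := ('X_{1..n} * 'I_m)%type.

Definition tact n m (t : 'X_{1..n}) (s : mterm n m) : mterm n m :=
  ((t + s.1)%MM, s.2).

(* Orderings are given by their strict part. *)
Definition strict_total (T : eqType) (lt : rel T) : Prop :=
  [/\ irreflexive lt, transitive lt & forall x y, x != y -> lt x y || lt y x].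

Definition term_ordering n (mu : rel 'X_{1..n}) : Prop :=
  [/\ strict_total mu,
      forall s t u, mu t u -> mu (s + t)%MM (s + u)%MM
    & forall t, t != 0%MM -> mu 0%MM t].

Definition module_ordering n m (mu' : rel (mterm n m)) : Prop :=
  [/\ strict_total mu',
      forall t s s', mu' s s' -> mu' (tact t s) (tact t s')
    & forall t s, (s == tact t s) || mu' s (tact t s)].

Definition compatible n m (mu : rel 'X_{1..n}) (mu' : rel (mterm n m)) : Prop :=
  forall t u i, mu t u -> mu' (t, i) (u, i).

Definition max_of (T : Type) (lt : rel T) (x y : T) : T :=
  if lt x y then y else x.

Definition max_seq (T : Type) (lt : rel T) (s : seq T) : option T :=
  foldr (fun x o => Some (if o is Some y then max_of lt x y else x)) None s.

(* Leading terms are options, [None] being the leading term of 0, which is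
   smaller than every term. *)
Definition olt (T : Type) (lt : rel T) (x y : option T) : bool :=
  match x, y with
  | None, Some _ => true
  | Some a, Some b => lt a b
  | _, None => false
  end.

Section Signatures.

Context (k : fieldType) (n m : nat).
Context (mu : rel 'X_{1..n}) (mu' : rel (mterm n m)).
Context (F : 'rV[{mpoly k[n]}]_m).

Implicit Types (f g h : {mpoly k[n]}) (w : 'rV[{mpoly k[n]}]_m).
Implicit Types (t : 'X_{1..n}) (s : mterm n m).

Definition LT f : option 'X_{1..n} := max_seq mu (msupp f).

(* [LT f] with a dummy value at f = 0, for use on nonzero polynomials only. *)
Definition LM f : 'X_{1..n} := odflt 0%MM (LT f).

Definition LC f : k := f@_(LM f).

Definition normalize f : {mpoly k[n]} := (LC f)^-1 *: f.

Definition mterms w : seq (mterm n m) :=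
  [seq (t, i) | i <- enum 'I_m, t <- msupp (w 0 i)].

Definition mLT w : option (mterm n m) := max_seq mu' (mterms w).

Definition vmap w : {mpoly k[n]} := \sum_(i < m) w 0 i * F 0 i.

Definition in_ideal f : Prop := exists w, vmap w = f.

Definition LT_Syz s : Prop := exists w, [/\ vmap w = 0, w != 0 & mLT w = Some s].

Definition NS_Syz s : Prop := ~ LT_Syz s.

(* Every f in the ideal has exactly one such preimage; [xget] returns it (and
   the junk value 0 when f is not in the ideal). *)
Definition nf_preimage f : 'rV[{mpoly k[n]}]_m :=
  xget 0 (fun w => vmap w = f /\ forall s, s \in mterms w -> NS_Syz s).

Definition Sig f : option (mterm n m) := mLT (nf_preimage f).

Definition S_irreducible f : Prop :=
  [/\ f != 0, in_ideal f
    & ~ exists h t (a : k),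
        [/\ h != 0, in_ideal h, a != 0,
            olt mu (LT (f - a *: ('X_[t] * h))) (LT f)
          & olt mu' (Sig ('X_[t] * h)) (Sig f)]].

Definition primitive_S_irreducible f : Prop :=
  S_irreducible f /\
  ~ exists f' t,
      [/\ S_irreducible f', t != 0%MM, LT ('X_[t] * f') = LT f,
          omap (tact t) (Sig f') = Sig ('X_[t] * f')
        & Sig ('X_[t] * f') = Sig f].

(* The coefficient u_1 of Spol(f, g) is (LC f)^-1 times the power product
   [cofactor f g], and u_2 is (LC g)^-1 times [cofactor g f]. *)
Definition cofactor f g : 'X_{1..n} := (mlcm (LM f) (LM g) - LM f)%MM.

Definition Spol f g : {mpoly k[n]} :=
  ((LC f)^-1 *: 'X_[cofactor f g]) * f - ((LC g)^-1 *: 'X_[cofactor g f]) * g.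

Definition mterm_vec s : 'rV[{mpoly k[n]}]_m := 'X_[s.1] *: delta_mx 0 s.2.

Definition in_span (L : {fset mterm n m}) s : Prop :=
  exists c : mterm n m -> {mpoly k[n]},
    mterm_vec s = \sum_(r <- L) c r *: mterm_vec r.

(* A labelled polynomial: a polynomial together with a module term. *)
Notation lpoly := ({mpoly k[n]} * mterm n m)%type.

Definition normal_pair (L : {fset mterm n m}) (p q : lpoly) : Prop :=
  [/\ primitive_S_irreducible p.1 /\ primitive_S_irreducible q.1,
      ~ in_span L (tact (cofactor p.1 q.1) p.2),
      ~ in_span L (tact (cofactor q.1 p.1) q.2)
    & tact (cofactor p.1 q.1) p.2 <> tact (cofactor q.1 p.1) q.2].

Definition new_pair (p q : lpoly) : lpoly :=
  (Spol p.1 q.1,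
   max_of mu' (tact (cofactor p.1 q.1) p.2) (tact (cofactor q.1 p.1) q.2)).

Definition prune_span (L : {fset mterm n m}) (B : {fset lpoly}) : {fset lpoly} :=
  [fset p in B | `[< ~ in_span L p.2 >]].

Definition covered (A : {fset lpoly}) (p : lpoly) : Prop :=
  exists q t, [/\ q \in A, tact t q.2 = p.2 & olt mu (LT ('X_[t] * q.1)) (LT p.1)].

Definition prune_covered (G B : {fset lpoly}) : {fset lpoly} :=
  [fset p in B | `[< ~ covered (G `|` B) p >]].

Definition prune (L : {fset mterm n m}) (G B : {fset lpoly}) : {fset lpoly} :=
  prune_covered G (prune_span L B).

Definition new_pairs (L : {fset mterm n m}) (G : {fset lpoly}) (p : lpoly) :
    {fset lpoly} :=
  [fset new_pair p q | q in G & `[< normal_pair L p q >]].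

(* The pair q of G, multiplied by t, can be used to S-reduce f at the module
   term s. *)
Definition reducer (G : {fset lpoly}) f s (q : lpoly) t : Prop :=
  [/\ f != 0, q \in G, omap (mnm_add t) (LT q.1) = LT f & mu' (tact t q.2) s].

(* [Loop L G B]: about to test the guard of the main loop.
   [Reduce L G B f s]: (f, s) has been removed from B and f is being S-reduced.
   [Return R]: the algorithm has stopped with output R. *)
Inductive config : Type :=
  | Loop of {fset mterm n m} & {fset lpoly} & {fset lpoly}
  | Reduce of {fset mterm n m} & {fset lpoly} & {fset lpoly}
      & {mpoly k[n]} & mterm n m
  | Return of {fset {mpoly k[n]}}.

(* One step of the algorithm. It is a relation because the selection of the
   minimal pair and of the reducers is left open. *)
Inductive step : config -> config -> Prop :=
  | StepGuard (L : {fset mterm n m}) (G : {fset lpoly}) :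
      step (Loop L G fset0) (Return [fset p.1 | p in G])
  | StepLeave (L : {fset mterm n m}) (G B : {fset lpoly})
      of B != fset0 & prune L G B = fset0 :
      step (Loop L G B) (Return [fset p.1 | p in G])
  | StepPick (L : {fset mterm n m}) (G B : {fset lpoly}) (p : lpoly)
      of B != fset0 & p \in prune L G B
      & (forall q : lpoly, q \in prune L G B -> ~~ mu' q.2 p.2) :
      step (Loop L G B) (Reduce L G (prune L G B `\ p) p.1 p.2)
  | StepReduce (L : {fset mterm n m}) (G B : {fset lpoly}) f s (q : lpoly) t
      of reducer G f s q t :
      step (Reduce L G B f s)
           (Reduce L G B (normalize f - (LC q.1)^-1 *: ('X_[t] * q.1)) s)
  | StepNonzero (L : {fset mterm n m}) (G B : {fset lpoly}) f s
      of f != 0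
      & (forall (q : lpoly) t, ~ reducer G f s q t) :
      step (Reduce L G B f s)
           (Loop L ((normalize f, s) |` G)
                 (B `|` new_pairs L G (normalize f, s)))
  | StepZero (L : {fset mterm n m}) (G B : {fset lpoly}) s :
      step (Reduce L G B 0 s) (Loop (s |` L) G B).

Definition init : config :=
  Loop fset0 fset0 [fset (F 0 i, (0%MM, i)) | i in 'I_m].

(* Whatever choices are made, the run from c reaches a [Return] after finitely
   many steps, without getting stuck on the way. *)
Inductive terminates (c : config) : Prop :=
  | Halted R of c = Return R
  | Running of (exists c', step c c') & (forall c', step c c' -> terminates c').

End Signatures.

(* Main.v *)
Require Import Defs.
From mathcomp Require Import all_boot all_order all_algebra.
From mathcomp Require Import finmap boolp classical_sets.

(** Every round of the main loop makes progress of one of three kinds, compared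
    lexicographically.

    - A zero result puts into [L] a module term outside the submodule that [L]
      spans, so no element of [L] divides it. By Dickson's lemma this happens
      finitely often; in well-founded form, sequences of terms none of which is
      divisible by an earlier one cannot be extended forever
      ([wqo_bad_seq_wf]).
    - A nonzero result f that is not primitive S-irreducible creates no pair,
      so [B] loses the pair picked.
    - A nonzero result f with label s that is primitive S-irreducible is
      entered in a history, together with s and the number of pairs with label
      s still in [B]. Dickson's lemma bounds the history as well, once a new
      entry (f, s) is known not to be divisible by an older one (h, r).

    For the last point suppose LT f = t LT h, s = t' r and Sig f = u Sig h. If
    t < t', then t h would still S-reduce f. If t' < t, then t' h covers the
    pair from which f was computed, and that pair would have been pruned. So
    t = t', and then t = 1 because f is primitive and h is S-irreducible
    ([primitive_dvd_eq1]). Hence r = s. But a pair created while label s is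
    treated has a label strictly above s ([new_pair_gt]), and no label is treated
    after a larger one, so each treatment of s lowers the number of pairs with
    label s in [B]: the new entry is not divisible by the older one in this last
    coordinate.

    The statements about signatures rest on a minimality property: Sig f is the
    least leading module term among all preimages of f ([Sig_min]). *)

Set Implicit Arguments.
Unset Strict Implicit.
Unset Printing Implicit Defensive.

Import GRing.Theory.

Local Open Scope fset_scope.
Local Open Scope ring_scope.

(** * Well-quasi-orders and Dickson's lemma *)

Lemma not_wf_descent (T : Type) (R : T -> T -> Prop) :
  ~ well_founded R -> exists u : nat -> T, forall i, R (u i.+1) (u i).
Proof.
move=> /existsNP[x0 Nx0].
have next x : exists y, ~ Acc R x -> R y x /\ ~ Acc R y.
  have [xA|xA] := pselect (Acc R x); first by exists x.
  apply: contrapT => /forallNP noy; apply: xA; split=> y yx.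
  by apply: contrapT => Ny; apply: (noy y).
have [f fP] := choice next.
have NAcc i : ~ Acc R (iter i f x0).
  by elim: i => //= i /fP[].
by exists (fun i => iter i f x0) => i /=; have [] := fP _ (NAcc i).
Qed.

(** Asking for a whole monotone subsequence, and not just for one increasing
    pair, makes stability under intersection a matter of extracting twice. *)
Definition wqo (T : Type) (R : T -> T -> Prop) : Prop :=
  forall u : nat -> T, exists phi : nat -> nat,
    (forall i j, (i < j)%N -> (phi i < phi j)%N) /\
    (forall i j, (i < j)%N -> R (u (phi i)) (u (phi j))).

(** Repeatedly taking the index of a minimal value among those not yet passed
    yields a nondecreasing subsequence. *)
Lemma wqo_leq : wqo (fun a b : nat => (a <= b)%N).
Proof.
move=> u.
have next N : exists i, (N <= i)%N /\ forall j, (N <= j)%N -> (u i <= u j)%N.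
  have exN : exists v, `[< exists2 i, (N <= i)%N & u i = v >].
    by exists (u N); apply/asboolP; exists N.
  case: (ex_minnP exN) => v /asboolP[i Ni <-] min_v; exists i; split=> // j Nj.
  by apply: min_v; apply/asboolP; exists j.
have [f fP] := choice next.
pose phi := fix phi i := if i is i'.+1 then f (phi i').+1 else f 0%N.
have phiS i : (phi i < phi i.+1)%N by have [] := fP (phi i).+1.
have phi_lt i j : (i < j)%N -> (phi i < phi j)%N.
  elim: j => // j IHj; rewrite ltnS leq_eqVlt => /orP[/eqP->//|ij].
  exact: ltn_trans (IHj ij) (phiS j).
exists phi; split=> // i j /phi_lt ij.
case: i ij => [|i] ij; first by have [_] := fP 0%N; apply.
have [lei min_i] := fP (phi i).+1; apply: min_i.
exact: leq_trans lei (ltnW ij).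
Qed.

Lemma wqo_pullback (T U : Type) (f : T -> U) (R : U -> U -> Prop) :
  wqo R -> wqo (fun x y => R (f x) (f y)).
Proof. by move=> Rwqo u; apply: (Rwqo (f \o u)). Qed.

Lemma wqo_and (T : Type) (R S : T -> T -> Prop) :
  wqo R -> wqo S -> wqo (fun x y => R x y /\ S x y).
Proof.
move=> Rwqo Swqo u; have [phi [phi_lt Rphi]] := Rwqo u.
have [psi [psi_lt Spsi]] := Swqo (u \o phi).
exists (phi \o psi); split=> i j ij /=; first exact/phi_lt/psi_lt.
by split; [apply/Rphi/psi_lt | apply: Spsi].
Qed.

Lemma wqo_sub (T : Type) (R S : T -> T -> Prop) :
  (forall x y, R x y -> S x y) -> wqo R -> wqo S.
Proof.
move=> RS Rwqo u; have [phi [phi_lt Rphi]] := Rwqo u.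
by exists phi; split=> // i j ij; apply/RS/Rphi.
Qed.

Lemma wqo_forall (T : Type) (I : finType) (R : I -> T -> T -> Prop) :
  (forall i, wqo (R i)) -> wqo (fun x y => forall i, R i x y).
Proof.
move=> Rwqo.
suff Renum : wqo (fun x y => forall i, i \in enum I -> R i x y).
  apply: wqo_sub Renum => x y Rxy i; apply: Rxy; exact: mem_enum.
elim: (enum I) => [|i r IHr]; first by move=> u; exists id.
apply: wqo_sub (wqo_and (Rwqo i) IHr) => x y [Ri Rr] j.
by rewrite inE => /orP[/eqP->|/Rr].
Qed.

Lemma wqo_wf (T : Type) (R lt : T -> T -> Prop) :
    wqo R -> (forall x y z, lt x y -> lt y z -> lt x z) ->
    (forall x y, R x y -> ~ lt y x) ->
  well_founded lt.
Proof.
move=> Rwqo lt_trans R_lt; apply: contrapT => /not_wf_descent[u uP].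
have [phi [phi_lt Rphi]] := Rwqo u; apply: R_lt (Rphi 0 1 isT)%N _.
have : (phi 0 < phi 1)%N by apply: phi_lt.
elim: (phi 1%N) => // j IHj; rewrite ltnS leq_eqVlt => /orP[/eqP->//|/IHj].
exact: lt_trans.
Qed.

(** The form in which finiteness is used: an infinite extension would produce
    an infinite sequence in which no element dominates an earlier one. It serves
    as an induction principle on the data collected so far. *)
Lemma wqo_bad_seq_wf (T : eqType) (R : T -> T -> Prop) : wqo R ->
  well_founded (fun l' l => exists2 x, l' = x :: l & forall y, y \in l -> ~ R y x).
Proof.
move=> Rwqo; apply: contrapT => /not_wf_descent[u uP].
have [x xP] : exists x : nat -> T, forall i,
    u i.+1 = x i :: u i /\ forall y, y \in u i -> ~ R y (x i).
  have next i : exists x, u i.+1 = x :: u i /\ forall y, y \in u i -> ~ R y x.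
    by have [x] := uP i; exists x.
  by have [x xP] := choice next; exists x.
have [phi [phi_lt Rphi]] := Rwqo x.
have [_ /(_ (x (phi 0%N)))] := xP (phi 1%N).
apply; last exact: Rphi.
have : (phi 0 < phi 1)%N by apply: phi_lt.
elim: (phi 1%N) => // j IHj; rewrite ltnS (proj1 (xP j)) inE leq_eqVlt.
by case/orP => [/eqP->|/IHj->]; rewrite ?eqxx ?orbT.
Qed.

Definition mdvd n m (s s' : mterm n m) : bool :=
  (s.1 <= s'.1)%MM && (s.2 == s'.2).

Lemma mdvdP n m (s s' : mterm n m) :
  reflect (exists t, s' = tact t s) (mdvd s s').
Proof.
apply: (iffP andP) => [[le_s /eqP eq_s]|[t ->]] /=.
  exists (s'.1 - s.1)%MM; rewrite /tact submK // eq_s; exact: surjective_pairing.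
by split=> //; apply: lem_addl.
Qed.

Lemma wqo_mnm_le n : wqo (fun t u : 'X_{1..n} => (t <= u)%MM).
Proof.
have wqo_i (i : 'I_n) : wqo (fun t u : 'X_{1..n} => (t i <= u i)%N).
  exact: (@wqo_pullback _ _ (fun t : 'X_{1..n} => t i)) wqo_leq.
by apply: wqo_sub (wqo_forall wqo_i) => t u tu; apply/mnm_lepP.
Qed.

(** Equality of indices is the conjunction of [<=] and its reverse, and the
    reverse is [<=] seen through [rev_ord]. *)
Lemma wqo_ord_eq m : wqo (fun i j : 'I_m => i = j).
Proof.
have wqo_le := @wqo_pullback _ _ (@nat_of_ord m) _ wqo_leq.
have wqo_ge := @wqo_pullback _ _ (@rev_ord m) _ wqo_le.
apply: wqo_sub (wqo_and wqo_le wqo_ge) => i j [le_ij /= le_ji].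
apply/val_inj/eqP; rewrite /= eqn_leq le_ij /=.
by rewrite leq_sub2lE // in le_ji.
Qed.

(** Dickson's lemma for module terms. *)
Lemma wqo_mdvd n m : wqo (fun s s' : mterm n m => mdvd s s').
Proof.
have wqo1 := @wqo_pullback (mterm n m) _ fst _ (@wqo_mnm_le n).
have wqo2 := @wqo_pullback (mterm n m) _ snd _ (@wqo_ord_eq m).
by apply: wqo_sub (wqo_and wqo1 wqo2) => s s' [??]; apply/andP; split=> //; apply/eqP.
Qed.

(** * Maxima of finite supports *)

Section StrictTotal.

Context (T : eqType) (lt : rel T).
Hypothesis lt_total : strict_total lt.

Let lt_irr : irreflexive lt. Proof. by case: lt_total. Qed.
Let lt_trans : transitive lt. Proof. by case: lt_total. Qed.

Lemma strict_cmp x y : [\/ lt x y, x = y | lt y x].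
Proof.
case: (eqVneq x y) => [->|xy]; first by constructor 2.
case: lt_total => _ _ /(_ _ _ xy)/orP[]; by [constructor 1|constructor 3].
Qed.

Lemma strict_asym x y : lt x y -> ~~ lt y x.
Proof. by move=> xy; apply/negP => /(lt_trans xy); rewrite lt_irr. Qed.

Lemma max_seqP s a :
  max_seq lt s = Some a <-> a \in s /\ forall b, b \in s -> (b == a) || lt b a.
Proof.
have max_in s' : s' != [::] -> exists2 a', max_seq lt s' = Some a' &
    a' \in s' /\ forall b, b \in s' -> (b == a') || lt b a'.
  elim: s' => // x s' IH _ /=; have [->|/IH[y -> [ys' ymax]]] := eqVneq s' [::].
    by exists x => //; rewrite inE eqxx; split=> // b; rewrite inE => ->.
  rewrite /max_of; case: ifPn => xy.
    exists y => //; rewrite inE ys' orbT; split=> // b; rewrite inE.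
    by case/orP => [/eqP->|/ymax//]; rewrite xy orbT.
  exists x => //; rewrite inE eqxx; split=> // b; rewrite inE.
  case/orP => [->//|/ymax by_].
  have : (y == x) || lt y x.
    by case: (strict_cmp x y) => [|->|->]; rewrite ?(negPf xy) ?eqxx ?orbT.
  case/orP => [/eqP<-//|yx]; apply/orP; right.
  by case/orP: by_ => [/eqP->//|/lt_trans]; apply.
split=> [maxs|[sa amax]].
  have [|a' maxs' ?] := max_in s; first by apply/eqP => s0; rewrite s0 in maxs.
  by move: maxs'; rewrite maxs => -[->].
have [|a' -> [sa' a'max]] := max_in s; first by apply/eqP => s0; rewrite s0 in sa.
have /orP[/eqP->//|aa'] := a'max a sa.
have /orP[/eqP->//|a'a] := amax a' sa'.
by rewrite (negPf (strict_asym aa')) in a'a.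
Qed.

Lemma max_seq_eq0 s : (max_seq lt s == None) = (s == [::]).
Proof. by case: s. Qed.

Lemma eq_max_seq s1 s2 : s1 =i s2 -> max_seq lt s1 = max_seq lt s2.
Proof.
move=> s12; case E: (max_seq lt s2) => [a|].
  move/max_seqP: E => [sa amax]; apply/max_seqP; split; first by rewrite s12.
  by move=> b; rewrite s12; apply: amax.
apply/eqP; move/eqP: E; rewrite !max_seq_eq0 => /eqP s20.
by case: s1 s12 => // x s1 /(_ x); rewrite s20 inE eqxx.
Qed.


Lemma olt_irr x : olt lt x x = false.
Proof. by case: x => //= x; rewrite lt_irr. Qed.

Lemma olt_trans x y z : olt lt x y -> olt lt y z -> olt lt x z.
Proof. by case: x y z => [x|] [y|] [z|] //=; apply: lt_trans. Qed.

Lemma olt_le_trans x y z : ~~ olt lt y x -> olt lt y z -> olt lt x z.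
Proof.
case: x y z => [x|] [y|] [z|] //= yx yz.
case: (strict_cmp x y) => [xy|->//|]; last by rewrite (negPf yx).
exact: lt_trans xy yz.
Qed.

Lemma olt_lt_le_trans x y z : olt lt x y -> ~~ olt lt z y -> olt lt x z.
Proof.
case: x y z => [x|] [y|] [z|] //= xy zy.
case: (strict_cmp y z) => [|<-//|]; last by rewrite (negPf zy).
exact: lt_trans.
Qed.

Lemma olt_anti x y : ~~ olt lt x y -> ~~ olt lt y x -> x = y.
Proof.
case: x y => [x|] [y|] //= xy yx.
by have [xy'|->|yx'] := strict_cmp x y; rewrite ?xy' ?yx' in xy yx.
Qed.

Lemma olt_wf :
  well_founded (fun x y => lt x y) -> well_founded (fun x y => olt lt x y).
Proof.
move=> lt_wf; have accN : Acc (fun x y => olt lt x y) None by split=> -[].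
case=> [x|]; last exact: accN.
elim: x / (lt_wf x) => x _ IHx; split=> -[y|_]; [exact: IHx | exact: accN].
Qed.

(** In this lemma and the next, [s1], [s2] and [s] stand for the supports of f,
    g and f - g, for polynomials as well as for vectors of polynomials: here
    the leading terms of f and g cancel. *)
Lemma max_seq_cancel s1 s2 s a :
    {subset s <= s1 ++ s2} -> a \notin s ->
    max_seq lt s1 = Some a -> max_seq lt s2 = Some a ->
  olt lt (max_seq lt s) (Some a).
Proof.
move=> sub_s Na /max_seqP[_ max1] /max_seqP[_ max2].
case E: (max_seq lt s) => [b|] //=; move/max_seqP: E => [sb _].
have ba : b != a by apply: contraNneq Na => <-.
have := sub_s b sb; rewrite mem_cat => /orP[/max1|/max2];
  by rewrite (negPf ba).
Qed.

Lemma max_seq_dominant s1 s2 s a :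
    {subset s <= s1 ++ s2} -> a \in s ->
    max_seq lt s1 = Some a -> olt lt (max_seq lt s2) (Some a) ->
  max_seq lt s = Some a.
Proof.
move=> sub_s sa /max_seqP[_ max1] lt2; apply/max_seqP; split=> // b /sub_s.
rewrite mem_cat => /orP[/max1//|s2b].
case E: (max_seq lt s2) lt2 => [c|] /= ca.
  move/max_seqP: E => [_ /(_ b s2b)/orP[/eqP->|bc]]; first by rewrite ca orbT.
  by rewrite (lt_trans bc ca) orbT.
by move/eqP: E; rewrite max_seq_eq0 => /eqP s20; rewrite s20 in s2b.
Qed.

Lemma olt_max_seq_notin s a : olt lt (max_seq lt s) (Some a) -> a \notin s.
Proof.
move=> sa; apply/negP => a_s; case E: (max_seq lt s) sa => [c|] /= ca.
  move/max_seqP: E => [_ /(_ a a_s)/orP[/eqP ac|ac]].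
    by rewrite ac lt_irr in ca.
  by rewrite (negPf (strict_asym ac)) in ca.
by move/eqP: E; rewrite max_seq_eq0 => /eqP s0; rewrite s0 in a_s.
Qed.

End StrictTotal.

(** * Term orderings *)

Section Orderings.

Context (n m : nat) (mu : rel 'X_{1..n}) (mu' : rel (mterm n m)).
Hypothesis mu_ord : term_ordering mu.
Hypothesis mu'_ord : module_ordering mu'.
Hypothesis mu_compat : compatible mu mu'.

Lemma mu_total : strict_total mu. Proof. by case: mu_ord. Qed.

Lemma mu'_total : strict_total mu'. Proof. by case: mu'_ord. Qed.

Lemma mu_add2l s t u : mu t u -> mu (s + t)%MM (s + u)%MM.
Proof. by case: mu_ord => _ + _; apply. Qed.

Lemma mu_add2r s t u : mu t u -> mu (t + s)%MM (u + s)%MM.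
Proof. by rewrite ![(_ + s)%MM]addmC; apply: mu_add2l. Qed.

Lemma mu'_tact2l t s s' : mu' s s' -> mu' (tact t s) (tact t s').
Proof. by case: mu'_ord => _ + _; apply. Qed.

Lemma mu'_tact2r t u s : mu t u -> mu' (tact t s) (tact u s).
Proof. by move=> tu; apply/mu_compat/mu_add2r. Qed.

Lemma tact0 (s : mterm n m) : tact 0%MM s = s.
Proof. by rewrite /tact add0m -surjective_pairing. Qed.

(** Divisibility is contained in the ordering and is a well-quasi-order, so the
    ordering admits no infinite descent; likewise for module terms. *)
Lemma mu_wf : well_founded (fun t u => mu t u).
Proof.
have [mu_irr mu_trans _] := mu_total.
apply: wqo_wf (@wqo_mnm_le n) _ _; first by move=> x y z; apply: mu_trans.
move=> t u tu; rewrite -(submK tu) => ut.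
have [d0|/eqP d0] := eqVneq (u - t)%MM 0%MM; first by rewrite d0 add0m mu_irr in ut.
case: mu_ord => _ _ /(_ _ (introN eqP d0))/(mu_add2r t).
by rewrite add0m => /mu_trans/(_ ut); rewrite mu_irr.
Qed.

Lemma mu'_wf : well_founded (fun s s' => mu' s s').
Proof.
have [mu'_irr mu'_trans _] := mu'_total.
apply: wqo_wf (@wqo_mdvd n m) _ _; first by move=> x y z; apply: mu'_trans.
move=> s _ /mdvdP[t ->] ts; case: mu'_ord => _ _ /(_ t s)/orP[/eqP e|st].
  by rewrite -e mu'_irr in ts.
by have := mu'_trans _ _ _ st ts; rewrite mu'_irr.
Qed.

End Orderings.

(** * Leading terms of polynomials *)

Section LeadingTerm.

Context (k : fieldType) (n : nat) (mu : rel 'X_{1..n}).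
Hypothesis mu_ord : term_ordering mu.

Implicit Types (f g : {mpoly k[n]}).

Let mu_tot := mu_total mu_ord.

Lemma LTP f a : LT mu f = Some a <->
  f@_a != 0 /\ forall b, f@_b != 0 -> (b == a) || mu b a.
Proof.
rewrite /LT (max_seqP mu_tot) mcoeff_msupp.
by split=> -[fa amax]; split=> // b fb; apply: amax; rewrite ?mcoeff_msupp // -mcoeff_msupp.
Qed.

Lemma LT_eq0 f : (LT mu f == None) = (f == 0).
Proof. by rewrite /LT max_seq_eq0 msupp_eq0. Qed.

Lemma LT_LM f : f != 0 -> LT mu f = Some (LM mu f).
Proof. by rewrite -LT_eq0 /LM; case: (LT mu f). Qed.

Lemma LC_neq0 f : f != 0 -> LC mu f != 0.
Proof. by move/LT_LM/LTP => []. Qed.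

Lemma LT_scale c f : c != 0 -> LT mu (c *: f) = LT mu f.
Proof.
by move=> c0; apply: (eq_max_seq mu_tot) => b; rewrite (perm_mem (msuppZ f c0)).
Qed.

Lemma LM_scale c f : c != 0 -> LM mu (c *: f) = LM mu f.
Proof. by move=> c0; rewrite /LM LT_scale. Qed.

Lemma normalize_neq0 f : f != 0 -> normalize mu f != 0.
Proof. by move=> f0; rewrite scaler_eq0 invr_eq0 (negPf (LC_neq0 f0)). Qed.

Lemma LT_normalize f : f != 0 -> LT mu (normalize mu f) = LT mu f.
Proof. by move=> f0; rewrite LT_scale // invr_eq0 LC_neq0. Qed.

Lemma LC_normalize f : f != 0 -> LC mu (normalize mu f) = 1.
Proof.
move=> f0; rewrite /LC /normalize LM_scale ?invr_eq0 ?LC_neq0 // mcoeffZ.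
by rewrite mulVf ?LC_neq0.
Qed.

Lemma mcoeffXM f t a : ('X_[t] * f)@_(t + a) = f@_a.
Proof. by rewrite mulrC mcoeffMX. Qed.

Lemma mcoeffXM_neq0 f t b :
  ('X_[t] * f)@_b != 0 -> exists2 a, b = (t + a)%MM & f@_a != 0.
Proof.
rewrite -mcoeff_msupp mulrC (perm_mem (msuppMX f t)) => /mapP[a fa ->].
by exists a; rewrite // -mcoeff_msupp.
Qed.

Lemma LT_mulX t f : LT mu ('X_[t] * f) = omap (mnm_add t) (LT mu f).
Proof.
have [->|f0] := eqVneq f 0; first by rewrite mulr0 /LT msupp0.
rewrite (LT_LM f0) /=; apply/LTP; rewrite mcoeffXM.
have /LTP[f_lm lm_max] := LT_LM f0; split=> // _ /mcoeffXM_neq0[a -> /lm_max].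
by case/orP => [/eqP->|/(mu_add2l mu_ord)->]; rewrite ?eqxx ?orbT.
Qed.

Lemma LT_sub_cancel f g a : LT mu f = Some a -> LT mu g = Some a ->
  f@_a = g@_a -> olt mu (LT mu (f - g)) (Some a).
Proof.
move=> fa ga eq_a; apply: (max_seq_cancel mu_tot) fa ga; first exact: msuppB_le.
by rewrite -mcoeff_eq0 mcoeffB eq_a subrr.
Qed.

Lemma LT_sub_dominant f g :
  olt mu (LT mu g) (LT mu f) -> LT mu (f - g) = LT mu f.
Proof.
have [->|f0] := eqVneq f 0; first by rewrite {2}/LT msupp0; case: (LT mu g).
rewrite (LT_LM f0) => gf.
apply: (max_seq_dominant mu_tot _ _ (LT_LM f0) gf); first exact: msuppB_le.
rewrite mcoeff_msupp mcoeffB.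
by rewrite (memN_msupp_eq0 (olt_max_seq_notin mu_tot gf)) subr0; apply: LC_neq0.
Qed.

Lemma LT_reduce f g t : f != 0 -> omap (mnm_add t) (LT mu g) = LT mu f ->
  olt mu (LT mu (f - (LC mu f / LC mu g) *: ('X_[t] * g))) (LT mu f).
Proof.
move=> f0 tgf; have g0 : g != 0.
  by rewrite -LT_eq0; apply: contraNneq f0 => g0; rewrite -LT_eq0 -tgf g0.
move: tgf; rewrite (LT_LM f0) (LT_LM g0) => -[tgf].
apply: LT_sub_cancel; first exact: LT_LM.
  rewrite LT_scale ?mulf_neq0 ?invr_eq0 ?LC_neq0 // LT_mulX (LT_LM g0) /=.
  by rewrite tgf.
rewrite mcoeffZ -{2}tgf mcoeffXM -/(LC mu g) divfK ?LC_neq0 //.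
Qed.

End LeadingTerm.

(** * Signatures *)

Section Signature.

Context (k : fieldType) (n m : nat).
Context (mu : rel 'X_{1..n}) (mu' : rel (mterm n m)).
Context (F : 'rV[{mpoly k[n]}]_m).
Hypothesis mu_ord : term_ordering mu.
Hypothesis mu'_ord : module_ordering mu'.
Hypothesis mu_compat : compatible mu mu'.

Implicit Types (f g h p : {mpoly k[n]}) (w z : 'rV[{mpoly k[n]}]_m).
Implicit Types (t : 'X_{1..n}) (s : mterm n m).

Let mu'_tot := mu'_total mu'_ord.

Definition vcoeff w s : k := (w 0 s.2)@_(s.1).

Lemma mem_mterms w s : (s \in mterms w) = (vcoeff w s != 0).
Proof.
rewrite -mcoeff_msupp; apply/allpairsPdep/idP => [[i [t [_ tw ->]]]//|sw].
by exists s.2, s.1; rewrite mem_enum -surjective_pairing.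
Qed.

Lemma mterms_eq0 w : (mterms w == [::]) = (w == 0).
Proof.
apply/eqP/eqP => [w0|->].
  apply/rowP => i; apply/mpolyP => t; rewrite mxE mcoeff0; apply/eqP/negPn/negP.
  by rewrite -[_@_ _]/(vcoeff w (t, i)) -mem_mterms w0.
case E: (mterms _) => [//|s r]; have := mem_head s r; rewrite -E.
by rewrite mem_mterms /vcoeff mxE mcoeff0 eqxx.
Qed.

Lemma vcoeffB w z s : vcoeff (w - z) s = vcoeff w s - vcoeff z s.
Proof. by rewrite /vcoeff !mxE mcoeffB. Qed.

Lemma mtermsB w z : {subset mterms (w - z) <= mterms w ++ mterms z}.
Proof.
move=> s; rewrite mem_cat !mem_mterms vcoeffB; apply: contraNT.
by rewrite negb_or !negbK => /andP[/eqP-> /eqP->]; rewrite subrr.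
Qed.

Lemma vcoeff_mulcX c t w s : vcoeff ((c *: 'X_[t]) *: w) (tact t s) = c * vcoeff w s.
Proof. by rewrite /vcoeff mxE -scalerAl mcoeffZ mcoeffXM. Qed.

Lemma mterms_mulcX c t w s' : s' \in mterms ((c *: 'X_[t]) *: w) ->
  exists2 s, s' = tact t s & s \in mterms w.
Proof.
rewrite mem_mterms /vcoeff mxE -scalerAl mcoeffZ mulf_eq0 negb_or => /andP[_].
case/mcoeffXM_neq0 => a s'E wa; exists (a, s'.2); last by rewrite mem_mterms.
by rewrite /tact /= -s'E -surjective_pairing.
Qed.

Lemma mLT_eq0 w : (mLT mu' w == None) = (w == 0).
Proof. by rewrite /mLT max_seq_eq0 mterms_eq0. Qed.

Lemma mLT_in w s : mLT mu' w = Some s -> s \in mterms w.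
Proof. by move/(max_seqP mu'_tot) => []. Qed.

Lemma mLT_mulcX c t w : c != 0 ->
  mLT mu' ((c *: 'X_[t]) *: w) = omap (tact t) (mLT mu' w).
Proof.
move=> c0; case E: (mLT mu' w) => [s|] /=; last first.
  by move/eqP: E; rewrite mLT_eq0 => /eqP->; apply/eqP; rewrite scaler0 mLT_eq0.
move/(max_seqP mu'_tot): E => [sw smax]; apply/(max_seqP mu'_tot); split.
  by rewrite mem_mterms vcoeff_mulcX mulf_neq0 // -mem_mterms.
move=> _ /mterms_mulcX[s' -> /smax/orP[/eqP->|s's]]; first by rewrite eqxx.
by rewrite (mu'_tact2l mu'_ord) ?orbT.
Qed.

Lemma mLT_mulX t w : mLT mu' ('X_[t] *: w) = omap (tact t) (mLT mu' w).
Proof. by rewrite -[X in X *: w]scale1r mLT_mulcX ?oner_eq0. Qed.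

Lemma mLT_sub_dominant w z :
  olt mu' (mLT mu' z) (mLT mu' w) -> mLT mu' (w - z) = mLT mu' w.
Proof.
case E: (mLT mu' w) => [s|]; last by case: (mLT mu' z).
move=> zs; apply: (max_seq_dominant mu'_tot _ _ E zs); first exact: mtermsB.
have := olt_max_seq_notin mu'_tot zs.
rewrite !mem_mterms vcoeffB negbK => /eqP->; rewrite subr0 -mem_mterms.
exact: mLT_in.
Qed.

(** One step of division in the free module. *)
Lemma mLT_reduce w z t s : mLT mu' w = Some (tact t s) -> mLT mu' z = Some s ->
  exists2 c, c != 0 & olt mu' (mLT mu' (w - (c *: 'X_[t]) *: z)) (mLT mu' w).
Proof.
move=> ws zs; have := mLT_in ws; have := mLT_in zs; rewrite !mem_mterms => z0 w0.
exists (vcoeff w (tact t s) / vcoeff z s); first by rewrite mulf_neq0 ?invr_eq0.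
rewrite ws; apply: (max_seq_cancel mu'_tot _ _ ws); first exact: mtermsB.
  by rewrite mem_mterms vcoeffB vcoeff_mulcX divfK // subrr eqxx.
by rewrite -[max_seq _ _]/(mLT mu' _) mLT_mulcX ?zs ?mulf_neq0 ?invr_eq0.
Qed.

Lemma vmapB w z : vmap F (w - z) = vmap F w - vmap F z.
Proof.
by rewrite /vmap -sumrB; apply: eq_bigr => i _; rewrite !mxE mulrBl.
Qed.

Lemma vmapZ p w : vmap F (p *: w) = p * vmap F w.
Proof.
by rewrite /vmap mulr_sumr; apply: eq_bigr => i _; rewrite !mxE mulrA.
Qed.

Local Notation NS := (NS_Syz mu' F).
Local Notation Sig := (Sig mu' F).
Local Notation nf := (nf_preimage mu' F).

(** Division by the syzygies, by induction on the leading module term s of w: if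
    s is the leading term of a syzygy, subtract a multiple of that syzygy;
    otherwise split off the term of w at s and put it back at the end. *)
Lemma normal_form_exists w :
  exists v, vmap F v = vmap F w /\ forall s, s \in mterms v -> NS s.
Proof.
move wo: (mLT mu' w) => o.
elim: o / (olt_wf (mu'_wf mu'_ord) o) w wo => {}o _ IH w wo.
have {}IH w' (lt_w' : olt mu' (mLT mu' w') (mLT mu' w)) : exists v,
    vmap F v = vmap F w' /\ forall s, s \in mterms v -> NS s.
  by apply: (IH (mLT mu' w') _ w' erefl); rewrite -wo.
case E: (mLT mu' w) => [s|]; last first.
  move/eqP: E; rewrite mLT_eq0 -mterms_eq0 => /eqP E.
  by exists w; split=> // s; rewrite E.
have [[z [z0 _ zs]]|Ns] := pselect (LT_Syz mu' F s).
  have ws : mLT mu' w = Some (tact 0%MM s) by rewrite tact0.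
  have [c _ /IH[v [vE vN]]] := mLT_reduce ws zs.
  by exists v; split=> //; rewrite vE vmapB vmapZ z0 mulr0 subr0.
(* The basis vector e_i, where i is the index of s. *)
pose d : 'rV[{mpoly k[n]}]_m := delta_mx 0 s.2.
have d_terms s' : (s' \in mterms d) = (s' == (0%MM, s.2)).
  case: s' => t i; rewrite mem_mterms /vcoeff mxE eqxx xpair_eqE /=.
  case: (i == s.2); rewrite ?andbF ?mcoeff0 ?eqxx // andbT mcoeff1.
  by case: (t == _); rewrite ?oner_eq0 ?eqxx.
have dE : mLT mu' d = Some (0%MM, s.2).
  apply/(max_seqP mu'_tot); split=> [|b]; rewrite d_terms //.
  by move->.
have ws : mLT mu' w = Some (tact s.1 (0%MM, s.2)).
  by rewrite /tact addm0 /= -surjective_pairing.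
have [c _ /IH[v [vE vN]]] := mLT_reduce ws dE.
exists (v - (- c *: 'X_[s.1]) *: d); split.
  by rewrite vmapB vE vmapB !vmapZ scaleNr mulNr opprK subrK.
move=> s' /mtermsB; rewrite mem_cat => /orP[/vN//|/mterms_mulcX[s0 ->]].
by rewrite d_terms => /eqP->; rewrite /tact addm0 -surjective_pairing.
Qed.

Lemma nf_preimageP f : in_ideal F f ->
  vmap F (nf f) = f /\ forall s, s \in mterms (nf f) -> NS s.
Proof.
case=> w wf; rewrite /nf_preimage.
apply: (@xgetPex _ 0 (fun v => vmap F v = f /\ forall s, s \in mterms v -> NS s)).
by have [v [vE vN]] := normal_form_exists w; exists v; rewrite vE.
Qed.

(** If w had a leading term below Sig f, the difference between the normal
    preimage of f and w would be a syzygy with leading term Sig f, which is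
    excluded by normality. *)
Lemma Sig_min f w : vmap F w = f -> ~~ olt mu' (mLT mu' w) (Sig f).
Proof.
move=> wf; have [nfE nfN] := nf_preimageP (ex_intro _ w wf).
apply/negP => lt_w; have sub_LT := mLT_sub_dominant lt_w.
case E: (Sig f) lt_w => [s|]; last by case: (mLT mu' w).
rewrite -/(Sig f) in sub_LT.
move=> lt_w; apply: (nfN s); first exact: mLT_in.
exists (nf f - w); rewrite vmapB nfE wf subrr sub_LT E; split=> //.
by rewrite -mLT_eq0 sub_LT E.
Qed.

Lemma Sig_neq0 f : in_ideal F f -> f != 0 -> exists s, Sig f = Some s.
Proof.
move=> /nf_preimageP[nfE _] f0; case E: (Sig f) => [s|]; first by exists s.
move/eqP: E; rewrite mLT_eq0 => /eqP nf0; rewrite -nfE nf0 in f0.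
by rewrite -(scale0r 0) vmapZ mul0r eqxx in f0.
Qed.

Lemma Sig_mulX f t : in_ideal F f ->
  ~~ olt mu' (omap (tact t) (Sig f)) (Sig ('X_[t] * f)).
Proof.
move=> /nf_preimageP[nfE _]; rewrite -mLT_mulX; apply: Sig_min.
by rewrite vmapZ nfE.
Qed.

(** A multiple of h with the leading term of g and a smaller signature would
    S-reduce g. *)
Lemma S_irreducible_Sig_mulX g h t :
    S_irreducible mu mu' F g -> h != 0 -> in_ideal F h ->
    LT mu ('X_[t] * h) = LT mu g ->
  ~~ olt mu' (Sig ('X_[t] * h)) (Sig g).
Proof.
move=> [g0 _ irr] h0 h_in LTth; apply/negP => lt_Sig; apply: irr.
exists h, t, (LC mu g / LC mu h).
rewrite mulf_neq0 ?invr_eq0 ?LC_neq0 //; split=> //.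
by apply: LT_reduce; rewrite // -LT_mulX.
Qed.

Lemma S_irreducible_Sig_min g g' :
    S_irreducible mu mu' F g -> in_ideal F g' -> LT mu g' = LT mu g ->
  ~~ olt mu' (Sig g') (Sig g).
Proof.
move=> g_irr g'_in g'g; have [g0 _ _] := g_irr.
have g'0 : g' != 0 by rewrite -(LT_eq0 mu) g'g LT_eq0.
have XE : 'X_[0%MM] * g' = g' by rewrite mpolyX0 mul1r.
by rewrite -XE; apply: S_irreducible_Sig_mulX; rewrite ?XE.
Qed.

(** A primitive S-irreducible g is not a proper multiple of an S-irreducible h,
    even if leading term and signature are allowed different cofactors. If
    t < u, then t h has the leading term of g and too small a signature. If
    u < t, subtracting from g the multiple of u h that cancels the signature
    keeps the leading term of g, since u LT h < LT g, and again lowers the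
    signature. If t = u, this is primitivity. *)
Lemma primitive_dvd_eq1 g h t u :
    primitive_S_irreducible mu mu' F g -> S_irreducible mu mu' F h ->
    LT mu g = omap (mnm_add t) (LT mu h) -> Sig g = omap (tact u) (Sig h) ->
  t = 0%MM.
Proof.
move=> [g_irr g_prim] h_irr LTg Sig_g.
have [[g0 g_in _] [h0 h_in _]] := (g_irr, h_irr).
have [s hs] := Sig_neq0 h_in h0; rewrite hs /= in Sig_g.
have LTth : LT mu ('X_[t] * h) = LT mu g by rewrite LT_mulX.
have Sig_th := S_irreducible_Sig_mulX g_irr h0 h_in LTth.
have Sig_th_le : ~~ olt mu' (Some (tact t s)) (Sig ('X_[t] * h)).
  by have := Sig_mulX t h_in; rewrite hs.
have [tu|tu|ut] := strict_cmp (mu_total mu_ord) t u.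
- case/negP: Sig_th; apply: (olt_le_trans mu'_tot Sig_th_le).
  by rewrite Sig_g /=; apply: (mu'_tact2r mu_ord mu_compat).
- rewrite -tu in Sig_g; have [//|t0] := eqVneq t 0%MM; case: g_prim; exists h, t.
  have Sig_thE : Sig ('X_[t] * h) = Sig g.
    by apply: (olt_anti mu'_tot Sig_th); rewrite Sig_g.
  by rewrite Sig_thE hs /= -Sig_g.
- have [nf_g _] := nf_preimageP g_in; have [nf_h _] := nf_preimageP h_in.
  have [c c0 lt_w] := mLT_reduce Sig_g hs.
  set w := _ - _ in lt_w; pose g' := g - (c *: 'X_[u]) * h.
  have g'E : vmap F w = g' by rewrite vmapB vmapZ nf_g nf_h.
  have g'_in : in_ideal F g' by exists w.
  have LTg' : LT mu g' = LT mu g.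
    apply: (LT_sub_dominant mu_ord); rewrite -scalerAl LT_scale // LT_mulX // LTg.
    by rewrite (LT_LM mu h0) /=; apply: (mu_add2r mu_ord).
  case/negP: (S_irreducible_Sig_min g_irr g'_in LTg').
  exact: (olt_le_trans mu'_tot (Sig_min g'E) lt_w).
Qed.

End Signature.

(** * Termination of the algorithm *)

Section Termination.

Context (k : fieldType) (n m : nat).
Context (mu : rel 'X_{1..n}) (mu' : rel (mterm n m)).
Context (F : 'rV[{mpoly k[n]}]_m).
Hypothesis mu_ord : term_ordering mu.
Hypothesis mu'_ord : module_ordering mu'.
Hypothesis mu_compat : compatible mu mu'.

Local Notation lpoly := ({mpoly k[n]} * mterm n m)%type.

Implicit Types (f g : {mpoly k[n]}) (t : 'X_{1..n}) (s r : mterm n m).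
Implicit Types (L : {fset mterm n m}) (G B A : {fset lpoly}) (p q : lpoly).

Let mu_tot := mu_total mu_ord.
Let mu'_tot := mu'_total mu'_ord.

Lemma in_span_dvd L r s : r \in L -> mdvd r s -> in_span k L s.
Proof.
move=> rL /mdvdP[t ->]; exists (fun r' => if r' == r then 'X_[t] else 0).
rewrite (bigD1_seq r) ?fset_uniq //= eqxx big1 ?addr0 => [|r' /negPf->].
  by rewrite /mterm_vec mpolyXD scalerA.
by rewrite scale0r.
Qed.

Lemma reducer_normalize G f s q t :
  reducer mu mu' G (normalize mu f) s q t <-> reducer mu mu' G f s q t.
Proof.
have [->|f0] := eqVneq f 0; first by rewrite /normalize scaler0.
split=> -[_ qG eqLT lt_s]; split=> //; rewrite ?normalize_neq0 //.
  by rewrite LT_normalize in eqLT.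
by rewrite LT_normalize.
Qed.

(** The label of the new pair is the larger of two distinct multiples of s and
    q.2, so it could equal s only if the cofactor of f were 1 and the other
    multiple were below s; but then q would be a reducer of f. *)
Lemma new_pair_gt L G f s q :
    (forall q t, ~ reducer mu mu' G f s q t) -> q \in G ->
    normal_pair mu mu' F L (f, s) q ->
  mu' s (new_pair mu mu' (f, s) q).2.
Proof.
move=> irr qG [[[[/= f0 _ _] _] [[q0 _ _] _]] _ _ neq].
have [mu'_irr mu'_trans _] := mu'_tot.
rewrite /= /max_of; set a := tact (Defs.cofactor mu f q.1) s in neq *.
set b := tact _ q.2 in neq *.
have le_sa : (s == a) || mu' s a by case: mu'_ord => _ _; apply.
case: ifPn => [ab|nab]; first by case/orP: le_sa => [/eqP->//|/mu'_trans]; apply.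
case/orP: le_sa => // /eqP sa; exfalso.
have ba : mu' b a by case: (strict_cmp mu'_tot a b) nab neq => [->|->|].
apply: (irr q (Defs.cofactor mu q.1 f)); split=> //; last by rewrite -/b sa.
have c0 : Defs.cofactor mu f q.1 = 0%MM.
  by have /= := congr1 fst sa; rewrite -{1}[s.1]add0m ![(_ + s.1)%MM]addmC => /addmI.
rewrite (LT_LM mu q0) (LT_LM mu f0) /=; congr Some.
rewrite /Defs.cofactor submK ?lem_mlcml // mlcmC.
by rewrite -(submK (lem_mlcml (LM mu f) (LM mu q.1))) -/(Defs.cofactor _ _ _) c0 add0m.
Qed.

(** Each S-reduction lowers the leading term, so the polynomial with which the
    main loop resumes has a leading term at most that of [f]. *)
Lemma reduce_terminates L G B f s :
    terminates mu mu' F (Loop (s |` L) G B) ->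
    (forall g, g != 0 -> (forall q t, ~ reducer mu mu' G g s q t) ->
       ~~ olt mu (LT mu f) (LT mu g) ->
     terminates mu mu' F (Loop L ((normalize mu g, s) |` G)
       (B `|` new_pairs mu mu' F L G (normalize mu g, s)))) ->
  terminates mu mu' F (Reduce L G B f s).
Proof.
move=> term0 term1; move fo: (LT mu f) => o.
elim: o / (olt_wf (mu_wf mu_ord) o) f fo term1 => {}o _ IH f fo term1.
apply: Running => [|c' st].
  have [->|f0] := eqVneq f 0; first by eexists; apply: StepZero.
  have [[q [t red]]|nored] := pselect (exists q t, reducer mu mu' G f s q t).
    by eexists; apply: (StepReduce F L B red).
  eexists; apply: StepNonzero f0 _ => q t red; apply: nored.
  by exists q, t.
inversion st as [| | |? ? ? ? ? q t red|? ? ? ? ? f0 nored|]; subst => //.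
  have [f0 _ tq _] := red.
  set f' := _ - _.
  have lt_f' : olt mu (LT mu f') (LT mu f).
    rewrite -(LT_normalize mu_ord f0) /f'.
    rewrite -[(LC mu q.1)^-1]div1r -{1}(LC_normalize mu_ord f0).
    by apply: LT_reduce; rewrite ?normalize_neq0 ?LT_normalize.
  apply: (IH (LT mu f')) => // g g0 nored le_g; apply: term1 => //.
  by apply: contraNN le_g => /(olt_trans mu_tot lt_f').
by apply: term1; rewrite ?olt_irr.
Qed.

Lemma prune_minP A : A != fset0 ->
  exists2 p, p \in A & forall q, q \in A -> ~~ mu' q.2 p.2.
Proof.
case/fset0Pn => p; move ps: p.2 => s.
elim: s / (mu'_wf mu'_ord s) p ps => {}s _ IH p ps pA; rewrite -ps in IH.
have [[q qA qp]|nolt] := pselect (exists2 q, q \in A & mu' q.2 p.2).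
  exact: (IH q.2 _ q).
by exists p => // q qA; apply/negP => qp; apply: nolt; exists q.
Qed.

Lemma in_pruneP L G B p : p \in prune mu L G B ->
  [/\ p \in B, ~ in_span k L p.2
    & forall q t, q \in G -> tact t q.2 = p.2 ->
        ~~ olt mu (LT mu ('X_[t] * q.1)) (LT mu p.1)].
Proof.
rewrite /prune /prune_covered !inE /= => /andP[/andP[pB /asboolP nspan] /asboolP ncov].
split=> // q t qG tq; apply/negP => lt_q; apply: ncov; exists q, t.
by split=> //; rewrite inE qG.
Qed.

Lemma prune_sub L G B : prune mu L G B `<=` B.
Proof. by apply/fsubsetP => p /in_pruneP[]. Qed.

Lemma card_fset_lt (T : choiceType) (C D : {fset T}) x :
  C `<=` D -> x \in D -> x \notin C -> (#|` C| < #|` D|)%N.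
Proof.
move=> CD xD xC; apply: fproper_ltn_card; rewrite fproperE CD.
by apply: contraNN xC => /fsubsetP; apply.
Qed.

Definition count_sig B s : nat := #|` [fset q in B | q.2 == s]|.

Lemma count_sig_sub A B s : A `<=` B -> (count_sig A s <= count_sig B s)%N.
Proof.
move=> /fsubsetP AB; apply/fsubset_leq_card/fsubsetP => q.
by rewrite !inE /= => /andP[/AB-> ->].
Qed.

Lemma count_sig_ltn A B p : A `<=` B -> p \in B -> p \notin A ->
  (count_sig A p.2 < count_sig B p.2)%N.
Proof.
move=> /fsubsetP AB pB pA; apply: (card_fset_lt (x := p)).
- by apply/fsubsetP => q; rewrite !inE /= => /andP[/AB-> ->].
- by rewrite !inE /= pB eqxx.
- by rewrite !inE /= (negPf pA).
Qed.

Lemma count_sigU A B s : (forall q, q \in B -> q.2 != s) ->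
  count_sig (A `|` B) s = count_sig A s.
Proof.
move=> Bs; congr #|` _|; apply/fsetP => q; rewrite !inE /=.
have [qB|] := boolP (q \in B); last by rewrite orbF.
by rewrite (negPf (Bs q qB)) !andbF.
Qed.

(** An entry ((f, s), c) of the history records a primitive S-irreducible result
    f, its label s, and the number c of pairs labelled s left in [B] when it was
    found. Reducers and coverings are governed by the label, primitivity by the
    signature, so divisibility is required of both. The value of [odflt] at
    None is arbitrary: signatures of nonzero ideal elements are never None. *)
Definition entry_dvd (e e' : lpoly * nat) : Prop :=
  [/\ (LM mu e.1.1 <= LM mu e'.1.1)%MM, mdvd e.1.2 e'.1.2,
      mdvd (odflt e.1.2 (Sig mu' F e.1.1)) (odflt e'.1.2 (Sig mu' F e'.1.1))
    & (e.2 <= e'.2)%N].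

Lemma wqo_entry_dvd : wqo entry_dvd.
Proof.
have w1 := @wqo_pullback (lpoly * nat) _ (fun e => LM mu e.1.1) _ (@wqo_mnm_le n).
have w2 := @wqo_pullback (lpoly * nat) _ (fun e => e.1.2) _ (@wqo_mdvd n m).
have w3 := @wqo_pullback (lpoly * nat) _
  (fun e => odflt e.1.2 (Sig mu' F e.1.1)) _ (@wqo_mdvd n m).
have w4 := @wqo_pullback (lpoly * nat) _ snd _ wqo_leq.
by apply: wqo_sub (wqo_and (wqo_and w1 w2) (wqo_and w3 w4)) => x y [[? ?] [? ?]].
Qed.

(** The two conditions on [B] persist because a pair with minimal label is
    picked and the pairs it creates have larger labels: the number of pairs with a
    label once treated never grows again. *)
Definition history G B (H : seq (lpoly * nat)) : Prop :=
  forall e, e \in H ->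
    [/\ e.1 \in G, primitive_S_irreducible mu mu' F e.1.1,
        forall q, q \in B -> ~~ mu' q.2 e.1.2
      & (count_sig B e.1.2 <= e.2)%N].

Lemma history_sub G G' A B H :
  G `<=` G' -> A `<=` B -> history G B H -> history G' A H.
Proof.
move=> /fsubsetP GG' AB HB e /HB[eG e_prim e_min e_cnt]; split=> //.
- exact: GG'.
- by move=> q qA; apply/e_min/(fsubsetP AB).
- exact: leq_trans (count_sig_sub _ AB) e_cnt.
Qed.

(** [p] is the pair picked, [A] what remains of [B], and [g] the result of
    S-reducing [p]. Writing t and t' for the cofactors of the leading terms and
    of the labels, t < t' contradicts that [g] admits no reducer, t' < t
    contradicts that [p] was not pruned, and t = t' forces equal labels, where
    the counts decide. *)
Lemma new_entry_bad L G A B p g H e :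
    history G B H -> e \in H -> p \in prune mu L G B ->
    A `<=` B -> p \notin A ->
    g != 0 -> (forall q t, ~ reducer mu mu' G g p.2 q t) ->
    ~~ olt mu (LT mu p.1) (LT mu g) ->
    primitive_S_irreducible mu mu' F (normalize mu g) ->
  ~ entry_dvd e ((normalize mu g, p.2), count_sig A p.2).
Proof.
move=> HB eH p_in AB pA g0 nored le_g g_prim [/= dvdLM dvd_s dvdSig le_cnt].
have [pB _ ncov] := in_pruneP p_in.
have [eG e_prim _ e_cnt] := HB e eH; have [e_irr _] := e_prim.
have [e0 e_in _] := e_irr; have [[g'0 g'_in _] _] := g_prim.
have LMg : LM mu (normalize mu g) = LM mu g.
  by rewrite LM_scale // invr_eq0 LC_neq0.
rewrite LMg in dvdLM; have tE := submK dvdLM; set t := (LM mu g - _)%MM in tE.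
have /mdvdP[t' pE] := dvd_s.
have LTg : LT mu (normalize mu g) = omap (mnm_add t) (LT mu e.1.1).
  by rewrite LT_normalize // !LT_LM //= tE.
have [tt'|tt'|t't] := strict_cmp mu_tot t t'.
- apply: (nored e.1 t); split=> //; first by rewrite -LTg LT_normalize.
  by rewrite pE; apply: (mu'_tact2r mu_ord mu_compat).
- have [sg Sig_g] := Sig_neq0 mu'_ord g'_in g'0.
  have [se Sig_e] := Sig_neq0 mu'_ord e_in e0.
  move: dvdSig; rewrite Sig_g Sig_e /= => /mdvdP[u sgE].
  have t0 : t = 0%MM.
    apply: (primitive_dvd_eq1 mu_ord mu'_ord mu_compat g_prim e_irr LTg (u := u)).
    by rewrite Sig_g Sig_e sgE.
  have sE : p.2 = e.1.2 by rewrite pE -tt' t0 tact0.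
  have := count_sig_ltn AB pB pA; rewrite sE in le_cnt *.
  by rewrite ltnNge (leq_trans e_cnt le_cnt).
- have /negP := ncov e.1 t' eG (esym pE); apply.
  rewrite LT_mulX //.
  have lt_g : olt mu (omap (mnm_add t') (LT mu e.1.1)) (LT mu g).
    by rewrite !LT_LM //= -tE; apply: (mu_add2r mu_ord).
  exact: (olt_lt_le_trans mu_tot lt_g).
Qed.

(** Lexicographic induction on the terms [Ls] known to have been put into [L],
    the history [H], and a bound on the size of [B]. *)
Lemma loop_terminates (Ls : seq (mterm n m)) (H : seq (lpoly * nat)) (N : nat) L G B :
    {subset Ls <= L} -> history G B H -> (#|` B| < N)%N ->
  terminates mu mu' F (Loop L G B).
Proof.
elim: Ls / (wqo_bad_seq_wf (@wqo_mdvd n m) Ls) H N L G B => {}Ls _ IHL H.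
elim: H / (wqo_bad_seq_wf wqo_entry_dvd H) => {}H _ IHH.
elim=> // N IHN L G B LsL HB leN.
apply: Running => [|c' st].
  have [->|B0] := eqVneq B fset0; first by eexists; apply: StepGuard.
  have [P0|/prune_minP[p pP p_min]] := eqVneq (prune mu L G B) fset0.
    by eexists; apply: StepLeave P0.
  by eexists; apply: StepPick pP p_min.
inversion st as [|? ? ? B0 P0|? ? ? p B0 pP p_min| | |]; subst.
- exact: Halted.
- exact: Halted.
set A := prune mu L G B `\ p.
have AB : A `<=` B by apply: fsubset_trans (prune_sub L G B); apply: fsubD1set.
have pA : p \notin A by rewrite !inE eqxx.
have [pB nspan _] := in_pruneP pP.
have ltAB := card_fset_lt AB pB pA.
apply: reduce_terminates => [|g g0 nored le_g].
  apply: (IHL (p.2 :: Ls) _ H N).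
  - exists p.2 => // r rLs r_dvd; apply: nspan; exact: in_span_dvd (LsL r rLs) r_dvd.
  - by move=> r; rewrite !inE => /orP[->//|/LsL->]; rewrite orbT.
  - exact: history_sub HB.
  - exact: leq_trans ltAB leN.
set f := normalize mu g.
have subG : G `<=` (f, p.2) |` G by apply: fsubsetUr.
have [f_prim|Nprim] := pselect (primitive_S_irreducible mu mu' F f); last first.
  have -> : new_pairs mu mu' F L G (f, p.2) = fset0.
    apply/eqP/fset0Pn => -[_ /imfsetP[q /= /andP[_ /asboolP[[]]]]] //.
  rewrite fsetU0; apply: IHN => //; first exact: history_sub HB.
  exact: leq_trans ltAB leN.
have new_gt q : q \in new_pairs mu mu' F L G (f, p.2) -> mu' p.2 q.2.
  case/imfsetP => q' /= /andP[q'G /asboolP norm] ->.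
  apply: new_pair_gt q'G norm => q'' t.
  by rewrite reducer_normalize; apply: nored.
have [mu'_irr mu'_trans _] := mu'_tot.
have new_neq s q : ~~ mu' p.2 s -> q \in new_pairs mu mu' F L G (f, p.2) -> q.2 != s.
  by move=> ps /new_gt; apply: contraTneq => ->.
pose e := ((f, p.2), count_sig A p.2).
set B' := A `|` _.
apply: (IHH (e :: H) _ #|` B'|.+1) => //.
  exists e => // e' e'H.
  exact: new_entry_bad HB e'H pP AB pA g0 nored le_g f_prim.
move=> e'; rewrite inE => /orP[/eqP->|e'H] /=.
  split=> //.
  - by rewrite !inE eqxx.
  - move=> q; rewrite inE => /orP[|/new_gt/(strict_asym mu'_tot)//].
    by rewrite in_fsetD1 => /andP[_ qP]; apply: p_min.
  - by rewrite /B' count_sigU // => q; apply: new_neq; rewrite mu'_irr.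
have [e'G e'_prim e'_min e'_cnt] := history_sub subG AB HB e'H.
have le_p : ~~ mu' p.2 e'.1.2 by have [_ _ ->] := HB e' e'H.
split=> //.
- move=> q; rewrite inE => /orP[/e'_min//|/new_gt pq].
  by apply: contraNN le_p; apply: mu'_trans pq.
- by rewrite /B' count_sigU // => q; apply: new_neq.
Qed.

End Termination.

Theorem proposition24 (k : fieldType) (n m : nat)
    (F : 'rV[{mpoly k[n]}]_m)
    (mu : rel 'X_{1..n}) (mu' : rel (mterm n m)) :
  term_ordering mu -> module_ordering mu' -> compatible mu mu' ->
  terminates mu mu' F (init F).
Proof.
move=> mu_ord mu'_ord mu_compat.
by apply: (loop_terminates mu_ord mu'_ord mu_compat (Ls := [::]) (H := [::])) (ltnSn _).
Qed.
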